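(* Let $G$ be a finite $2$-group with $d(G)=3$, $\Phi(G)\le Z(G)$ and $G'\cong C_2^3$. Suppose the type of $G/G'$ is $(2^{m},2^{m},2^{m})$ with $m\ge2$. Then one can choose suitable (characteristic) generators of $G$ such that the characteristic matrix of $G$ is one of the following matrices, where different types of matrix give non-isomorphic groups. (P1) $e_{11}+e_{22}+e_{33}$; (P2) $e_{11}+e_{22}+e_{32}+e_{33}$; (P3) $e_{11}+e_{12}+e_{13}+e_{22}+e_{33}$; (P4) $e_{11}+e_{13}+e_{23}+e_{32}$; (Q1) $e_{11}+e_{22}$; (Q2) $e_{12}+e_{21}$; (Q3) $e_{11}+e_{21}+e_{22}$; (Q4) $e_{13}+e_{22}$; (Q5) $e_{12}+e_{23}$; (R1) $e_{12}$; (R2) $e_{11}$; (R3) $0$.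
   Context: $d(G)$ is the minimal number of generators of $G$, $\Phi(G)$ the Frattini subgroup, $G'$ the derived subgroup, $C_2^3$ the elementary abelian group of order $8$. $F_2$ is the field with $2$ elements. $e_{ij}$ denotes the $3\times3$ matrix over $F_2$ with $1$ in position $(i,j)$ and $0$ elsewhere. Characteristic matrix: let $G$ be a finite $2$-group with $d(G)=3$, $\Phi(G)\le Z(G)$, $G'\cong C_2^3$, and $G/G'$ of type $(2^{m_1},2^{m_2},2^{m_3})$, $m_1\ge m_2\ge m_3\ge1$ (i.e. $G/G'\cong C_{2^{m_1}}\times C_{2^{m_2}}\times C_{2^{m_3}}$). Choose $a_1,a_2,a_3\in G$ with $G/G'=\langle a_1G'\rangle\times\langle a_2G'\rangle\times\langle a_3G'\rangle$, $o(a_iG')=2^{m_i}$. Then $G=\langle a_1,a_2,a_3\rangle$, and $G'=\langle x,y,z\rangle$ with $x=[a_2,a_3]$, $y=[a_3,a_1]$, $z=[a_1,a_2]$. Write $a_i^{2^{m_i}}=x^{w_{i1}}y^{w_{i2}}z^{w_{i3}}$ for $i=1,2,3$. The $3\times3$ matrix $w(G)=(w_{ij})$ over $F_2$ is called a characteristic matrix of $G$, and $a_1,a_2,a_3$ a set of characteristic generators about $w(G)$ (the matrix depends on the choice of generators). A characteristic matrix together with $m_1,m_2,m_3$ determines $G$ up to isomorphism. *)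

(* Defs.v *)
From mathcomp Require Import all_boot all_order all_fingroup all_algebra.
From mathcomp Require Import all_solvable.

Set Implicit Arguments.
Unset Strict Implicit.
Unset Printing Implicit Defensive.

Import GroupScope.

Section CharacteristicMatrix.

Variables (gT : finGroupType) (G : {group gT}) (m1 m2 m3 : nat).

(* [abelian_type] lists the orders of the cyclic factors of an abelian        *)
(* p-group in descending order, so the last conjunct is [m1 >= m2 >= m3 >= 1] *)
(* and [G / G' = C_{2^m1} x C_{2^m2} x C_{2^m3}].                             *)
Definition char_setting : Prop :=
  [/\ 2.-group G,
      'm(G) = 3,
      'Phi(G) \subset 'Z(G),
      2.-abelem G^`(1) /\ #|G^`(1)| = 8
    & [/\ (m3 <= m2 <= m1)%N, (1 <= m3)%N
        & abelian_type (G / G^`(1)) = [:: (2 ^ m1)%N; (2 ^ m2)%N; (2 ^ m3)%N]]].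

Definition char_gens (a1 a2 a3 : gT) : Prop :=
  [/\ [/\ a1 \in G, a2 \in G & a3 \in G],
      <[coset G^`(1) a1]> \x <[coset G^`(1) a2]> \x <[coset G^`(1) a3]>
        = G / G^`(1)
    & [/\ #[coset G^`(1) a1] = (2 ^ m1)%N,
          #[coset G^`(1) a2] = (2 ^ m2)%N
        & #[coset G^`(1) a3] = (2 ^ m3)%N]].

(* The indices 1, 2, 3 are the ordinals 0, 1, 2 of ['I_3]; an element         *)
(* of ['F_2] used as an exponent stands for its representative 0 or 1.        *)
Definition is_char_matrix (a1 a2 a3 : gT) (w : 'M['F_2]_3) : Prop :=
  let x := [~ a2, a3] in
  let y := [~ a3, a1] in
  let z := [~ a1, a2] in
  let word (i : 'I_3) :=
    x ^+ w i (inord 0) * y ^+ w i (inord 1) * z ^+ w i (inord 2) in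
  [/\ char_gens a1 a2 a3,
      a1 ^+ (2 ^ m1)%N = word (inord 0),
      a2 ^+ (2 ^ m2)%N = word (inord 1)
    & a3 ^+ (2 ^ m3)%N = word (inord 2)].

End CharacteristicMatrix.

Local Open Scope ring_scope.

(* The matrix unit e_{ij}, with 1-based indices [i] and [j]. *)
Definition e (i j : nat) : 'M['F_2]_3 := delta_mx (inord i.-1) (inord j.-1).

Definition types_PQR : 12.-tuple 'M['F_2]_3 :=
  [tuple
    (* P1 *) e 1 1 + e 2 2 + e 3 3;
    (* P2 *) e 1 1 + e 2 2 + e 3 2 + e 3 3;
    (* P3 *) e 1 1 + e 1 2 + e 1 3 + e 2 2 + e 3 3;
    (* P4 *) e 1 1 + e 1 3 + e 2 3 + e 3 2;
    (* Q1 *) e 1 1 + e 2 2;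
    (* Q2 *) e 1 2 + e 2 1;
    (* Q3 *) e 1 1 + e 2 1 + e 2 2;
    (* Q4 *) e 1 3 + e 2 2;
    (* Q5 *) e 1 2 + e 2 3;
    (* R1 *) e 1 2;
    (* R2 *) e 1 1;
    (* R3 *) 0].

(* Main.v *)
Require Import Defs.
From mathcomp Require Import all_boot all_order all_fingroup all_algebra.
From mathcomp Require Import all_solvable.

Set Implicit Arguments.
Unset Strict Implicit.
Unset Printing Implicit Defensive.

Import GroupScope.

(* Since m >= 2 and G' is central of exponent 2, g |-> g^(2^m) is a           *)
(* homomorphism G -> G' that factors through V = G / Phi(G) = F_2^3, while    *)
(* commutation induces an isomorphism from the exterior square of V to G'.    *)
(* The characteristic matrix is the matrix of the former map, with G'         *)
(* identified with the exterior square through the latter. If the generators  *)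
(* change by X in GL_3(F_2), then x, y, z change by the cofactor matrix of X, *)
(* that is, by X^-T, so that w becomes X w X^T. As m1 = m2 = m3, every        *)
(* generating triple is a set of characteristic generators, so isomorphism    *)
(* classes correspond to congruence classes of 3 x 3 matrices over F_2; that  *)
(* the twelve given matrices represent each class once is a finite            *)
(* computation.                                                               *)

(** Both halves reduce to the finite checks [congr_types_exists] and [congr_types_inj]. By
    [char_gens_generate], characteristic generators are just generating triples; by
    [word_comm3_inj], a word in x, y, z determines its exponents. Hence [congr_gens] realizes any
    congruence by a change of generators, and [gens_congr] recovers a congruence from two generating
    triples of one group. For two isomorphic groups, [morph_gens] first brings both triples into the
    same group. *)

Definition triple (T : Type) : Type := (T * T * T)%type.

Definition map3 (S T : Type) (f : S -> T) (t : triple S) : triple T :=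
  (f t.1.1, f t.1.2, f t.2).

Definition in3 (T : finType) (A : {set T}) (t : triple T) : bool :=
  [&& t.1.1 \in A, t.1.2 \in A & t.2 \in A].

Definition set3 (T : finType) (t : triple T) : {set T} :=
  [set t.1.1; t.1.2; t.2].

Lemma set3_subset (T : finType) (t : triple T) (A : {set T}) :
  (set3 t \subset A) = in3 A t.
Proof. by rewrite /set3 !subUset !sub1set /in3 andbA. Qed.

(* Vectors and matrices (lists of rows) over F_2, in a form that computes. *)
Notation bvec := (triple bool).
Notation bmat := (triple (triple bool)).

Definition xorv (u v : bvec) : bvec :=
  (u.1.1 (+) v.1.1, u.1.2 (+) v.1.2, u.2 (+) v.2).

Definition scalev (b : bool) (v : bvec) : bvec := map3 (andb b) v.

Definition mulvm (v : bvec) (M : bmat) : bvec :=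
  xorv (xorv (scalev v.1.1 M.1.1) (scalev v.1.2 M.1.2)) (scalev v.2 M.2).

Definition mulm (A B : bmat) : bmat := map3 (mulvm^~ B) A.

Definition transm (A : bmat) : bmat :=
  ((A.1.1.1.1, A.1.2.1.1, A.2.1.1),
   (A.1.1.1.2, A.1.2.1.2, A.2.1.2),
   (A.1.1.2, A.1.2.2, A.2.2)).

Definition onem : bmat :=
  ((true, false, false), (false, true, false), (false, false, true)).

(** Coordinates of the exterior product of u and v in the basis x, y, z; signs disappear in
    characteristic 2. *)
Definition cross (u v : bvec) : bvec :=
  ((u.1.2 && v.2) (+) (u.2 && v.1.2),
   (u.2 && v.1.1) (+) (u.1.1 && v.2),
   (u.1.1 && v.1.2) (+) (u.1.2 && v.1.1)).

Definition cofm (A : bmat) : bmat :=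
  (cross A.1.2 A.2, cross A.2 A.1.1, cross A.1.1 A.1.2).

(* Over F_2 the inverse of an invertible matrix is its adjugate. *)
Definition invertible_bmat (A : bmat) : bool :=
  mulm (transm (cofm A)) A == onem.

(* As [cofm X] is the inverse of [X^T], this says [W' = X W X^T] for          *)
(* invertible [X].                                                            *)
Definition congr_by (X W W' : bmat) : bool := mulm X W == mulm W' (cofm X).

Definition bits (w : 'M['F_2]_3) : bmat :=
  let row i :=
    (odd (w i (inord 0)), odd (w i (inord 1)), odd (w i (inord 2))) in
  (row (inord 0), row (inord 1), row (inord 2)).

Definition bit_types : seq bmat :=
  let v000 := (false, false, false) in
  let v100 := (true, false, false) in
  let v010 := (false, true, false) in
  let v001 := (false, false, true) in
  [:: (v100, v010, v001);
      (v100, v010, (false, true, true));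
      ((true, true, true), v010, v001);
      ((true, false, true), v001, v010);
      (v100, v010, v000);
      (v010, v100, v000);
      (v100, (true, true, false), v000);
      (v001, v010, v000);
      (v010, v001, v000);
      (v010, v000, v000);
      (v100, v000, v000);
      (v000, v000, v000)].

Lemma bits_types (k : 'I_12) :
  bits (tnth types_PQR k) = nth onem bit_types k.
Proof.
have E0 : (inord 0 : 'I_3) = ord0 by apply: val_inj; rewrite /= inordK.
have E1 : (inord 1 : 'I_3) = lift ord0 ord0.
  by apply: val_inj; rewrite /= inordK.
have E2 : (inord 2 : 'I_3) = ord_max by apply: val_inj; rewrite /= inordK.
by case: k => -[|[|[|[|[|[|[|[|[|[|[|[|//]]]]]]]]]]]] kP;
  rewrite /bits (tnth_nth 0%R) /= /e /= ?E0 ?E1 ?E2 !mxE /=.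
Qed.

(** * Congruence classes of 3 x 3 matrices over F_2, by enumeration *)

Definition bvecs : seq bvec :=
  [seq (bc.1, bc.2, a) | bc <- [:: (false, false); (false, true);
     (true, false); (true, true)], a <- [:: false; true]].

Definition bmats : seq bmat :=
  [seq (rs.1, rs.2, t) | rs <- [seq (r, s) | r <- bvecs, s <- bvecs],
                         t <- bvecs].

Lemma mem_bvecs v : v \in bvecs.
Proof. by case: v => [[[] []] []]. Qed.

Lemma mem_bmats A : A \in bmats.
Proof.
case: A => [[r s] t].
by apply/allpairsP; exists ((r, s), t); rewrite allpairs_f ?mem_bvecs.
Qed.

(* Unlike [has], this stops at the first hit even under call by value. *)
Fixpoint lazy_has (T : Type) (p : T -> bool) (s : seq T) : bool :=
  if s is x :: s' then if p x then true else lazy_has p s' else false.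

Lemma lazy_hasE (T : Type) (p : T -> bool) s : lazy_has p s = has p s.
Proof. by elim: s => //= x s ->; case: (p x). Qed.

(** Exhaustive search: each of the 512 matrices is tested against the 168 invertible X. *)
Lemma congr_types_exists (W : bmat) :
  exists X k, [/\ invertible_bmat X, (k < 12)%N
    & congr_by X W (nth onem bit_types k)].
Proof.
pose test W X := has (congr_by X W) bit_types.
have H :
    all (fun W => lazy_has (test W) [seq X <- bmats | invertible_bmat X]) bmats.
  by vm_compute.
have /allP/(_ W (mem_bmats W)) := H; rewrite lazy_hasE => /hasP[X].
rewrite mem_filter => /andP[invX _] /(has_nthP onem)[k ltk cXk].
by exists X, k; split; [exact: invX | exact: ltk | exact: cXk].
Qed.

(** Invertibility of X enters through its cofactor matrix, the form in which [gens_congr] supplies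
    it. *)
Lemma congr_types_inj X k l :
    (k < 12)%N -> (l < 12)%N -> injective (mulvm^~ (cofm X)) ->
    congr_by X (nth onem bit_types k) (nth onem bit_types l) ->
  k = l.
Proof.
move=> ltk ltl injX cX; pose v0 : bvec := (false, false, false).
(* A trivial kernel is a decidable consequence of injectivity, so it can filter the enumeration. *)
pose inj X := all (fun u => (mulvm u (cofm X) == v0) ==> (u == v0)) bvecs.
have H : all (fun X => all (fun k => all (fun l =>
    congr_by X (nth onem bit_types k) (nth onem bit_types l) ==> (k == l))
    (iota 0 12)) (iota 0 12)) [seq X <- bmats | inj X].
  by vm_compute.
have XP : X \in [seq X <- bmats | inj X].
  rewrite mem_filter mem_bmats andbT; apply/allP=> u _.
  by apply/implyP=> /eqP u0; apply/eqP/injX; rewrite /= u0.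
have ltP i : (i < 12)%N -> i \in iota 0 12 by rewrite mem_iota.
have /allP/(_ X XP)/allP/(_ _ (ltP _ ltk))/allP/(_ _ (ltP _ ltl)) := H.
by move/implyP/(_ cX)/eqP.
Qed.

(** * Words in three elements with exponent vectors over F_2 *)

Definition word (gT : finGroupType) (t : triple gT) (v : bvec) : gT :=
  t.1.1 ^+ v.1.1 * t.1.2 ^+ v.1.2 * t.2 ^+ v.2.

Definition comm3 (gT : finGroupType) (t : triple gT) : triple gT :=
  ([~ t.1.2, t.2], [~ t.2, t.1.1], [~ t.1.1, t.1.2]).

Lemma word_in (gT : finGroupType) (G : {group gT}) t v :
  in3 G t -> word t v \in G.
Proof. by case/and3P=> *; rewrite !groupM ?groupX. Qed.

Lemma morph_word (gT rT : finGroupType) (G : {group gT}) (f : gT -> rT) t v :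
    {in G &, {morph f : g h / g * h}} -> in3 G t ->
  f (word t v) = word (map3 f t) v.
Proof.
move=> fM /and3P[t1 t2 t3].
have f1 : f 1 = 1 by apply: (mulgI (f 1)); rewrite -fM // !mulg1.
have fX (g : gT) (b : bool) : f (g ^+ b) = f g ^+ b by case: b.
by rewrite /word !fM ?groupM ?groupX // !fX.
Qed.

Section WordsInAbelem.

Variables (gT : finGroupType) (E : {group gT}).
Hypothesis abelE : 2.-abelem E.

Let sq1 g : g \in E -> g * g = 1.
Proof. by case/(abelemP (isT : prime 2)): abelE => _ /(_ g). Qed.

Let mulACA g h g' h' : h \in E -> g' \in E ->
  g * h * (g' * h') = g * g' * (h * h').
Proof.
move=> Eh Eg'; rewrite -!mulgA; congr (_ * _); rewrite !mulgA.
by rewrite (centsP (abelem_abelian abelE) h).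
Qed.

Lemma word_xorv t u v :
  in3 E t -> word t (xorv u v) = word t u * word t v.
Proof.
case/and3P=> t1 t2 t3.
have expD g (a b : bool) : g \in E -> g ^+ (a (+) b) = g ^+ a * g ^+ b.
  by case: a b => -[] Eg; rewrite ?expg1 ?expg0 ?mulg1 ?mul1g ?sq1.
rewrite /word !expD // [RHS]mulACA ?groupM ?groupX //.
by congr (_ * _); rewrite mulACA ?groupX.
Qed.

Lemma word_mulvm t M v :
  in3 E t -> word (map3 (word t) M) v = word t (mulvm v M).
Proof.
move=> Et; have wZ b r : word t (scalev b r) = word t r ^+ b.
  by case: r => -[? ?] ?; case: b; rewrite /scalev /map3 /word /= ?mulg1.
by rewrite /mulvm !word_xorv // !wZ.
Qed.

End WordsInAbelem.

Lemma map3_word_mulm (gT : finGroupType) (E : {group gT}) t A B :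
    2.-abelem E -> in3 E t ->
  map3 (word (map3 (word t) B)) A = map3 (word t) (mulm A B).
Proof. by move=> abE Et; rewrite /map3 /= !(word_mulvm abE). Qed.

(** * Generating triples of a homocyclic group of rank 3 *)

(** The product of the three orders is n^3 times the orders of the two successive intersections. As
    each order is at most n, all equal n and both intersections are trivial. *)
Lemma dprod_cycle3_card (gT : finGroupType) (B : {group gT}) x y z n :
    abelian B -> x \in B -> y \in B -> z \in B ->
    B \subset <<[set x; y; z]>> ->
    exponent B %| n -> #|B| = (n ^ 3)%N ->
  <[x]> \x <[y]> \x <[z]> = B /\ [/\ #[x] = n, #[y] = n & #[z] = n].
Proof.
move=> cB Bx By Bz genB eB cardB.
have n_gt0 : 0 < n by move: (cardG_gt0 B); rewrite cardB expn_gt0 orbF.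
have le_n g : g \in B -> #[g] <= n.
  by move=> Bg; rewrite dvdn_leq // (dvdn_trans (dvdn_exponent Bg)).
have sB g : g \in B -> <[g]> \subset B by rewrite cycle_subG.
have cc g h : g \in B -> h \in B -> <[h]> \subset 'C(<[g]>).
  by move=> Bg Bh; rewrite (sub_abelian_cent2 cB) ?sB.
have cxy := cc _ _ Bx By.
have cxyz : <[z]> \subset 'C(<[x]> <*> <[y]>).
  by rewrite centY subsetI !cc.
have defB : <[x]> <*> <[y]> * <[z]> = B.
  apply/eqP; rewrite eqEsubset mul_subG ?join_subG ?sB //=.
  rewrite -(cent_joinEr cxyz) (subset_trans genB) // gen_subG.
  apply/subsetP=> g; rewrite !inE -orbA => /or3P[]/eqP->.
  - by rewrite mem_gen // inE mem_gen // inE cycle_id.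
  - by rewrite mem_gen // inE mem_gen // inE cycle_id orbT.
  - by rewrite mem_gen // inE cycle_id orbT.
have E1 := mul_cardG <[x]> <[y]>.
have E2 := mul_cardG (<[x]> <*> <[y]>)%G <[z]>.
rewrite -(cent_joinEr cxy) in E1; rewrite /= defB cardB in E2.
set p := #|_ :&: <[y]>| in E1; set q := #|_ :&: <[z]>| in E2.
have p0 : 0 < p by apply: cardG_gt0.
have q0 : 0 < q by apply: cardG_gt0.
have Ox := le_n _ Bx; have Oy := le_n _ By; have Oz := le_n _ Bz.
rewrite -!orderE in E1 E2.
have card_xyz : (#[x] * #[y] * #[z] = n ^ 3 * (q * p))%N.
  by rewrite E1 mulnAC E2 mulnA.
have n3 : n ^ 3 <= #[x] * #[y] * #[z].
  by rewrite card_xyz leq_pmulr // muln_gt0 q0.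
have nn : 0 < n * n by rewrite muln_gt0 n_gt0.
have n3E : (n ^ 3 = n * (n * n))%N by [].
have nx : n <= #[x].
  rewrite -(leq_pmul2r nn) -n3E; apply: leq_trans n3 _.
  by rewrite -mulnA leq_mul2l leq_mul ?orbT.
have ny : n <= #[y].
  rewrite -(leq_pmul2r nn) -n3E; apply: leq_trans n3 _.
  by rewrite mulnAC (mulnC _ #[y]) leq_mul2l leq_mul ?orbT.
have nz : n <= #[z].
  rewrite -(leq_pmul2r nn) -n3E; apply: leq_trans n3 _.
  by rewrite mulnC leq_mul2l leq_mul ?orbT.
have {Ox nx}ox : #[x] = n by apply/eqP; rewrite eqn_leq Ox.
have {Oy ny}oy : #[y] = n by apply/eqP; rewrite eqn_leq Oy.
have {Oz nz}oz : #[z] = n by apply/eqP; rewrite eqn_leq Oz.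
have /eqP : (q * p = 1)%N.
  apply/eqP; rewrite -(eqn_pmul2l (_ : 0 < n ^ 3)) ?expn_gt0 ?n_gt0 //.
  by rewrite -card_xyz ox oy oz muln1 n3E mulnA.
rewrite muln_eq1 => /andP[/eqP q1 /eqP p1]; split=> //.
have tixy : <[x]> :&: <[y]> = 1 by apply/eqP; rewrite trivg_card1 -/p p1.
have tixyz : <[x]> <*> <[y]> :&: <[z]> = 1.
  by apply/eqP; rewrite trivg_card1 -/q q1.
by rewrite (dprodEY cxy tixy) dprodE.
Qed.

Definition pow2 (gT : finGroupType) (m : nat) (g : gT) : gT := g ^+ (2 ^ m).

Lemma gens_subG (gT : finGroupType) (A : {set gT}) (G H : {group gT}) :
  <<A>> = G -> (G \subset H) = (A \subset H).
Proof. by move=> <-; rewrite gen_subG. Qed.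

(** * Commutators, 2^m-th powers and generating triples of G *)

Section CharacteristicGenerators.

Variables (gT : finGroupType) (G : {group gT}) (m : nat).
Hypothesis m_ge2 : 2 <= m.
Hypothesis settingG : char_setting G m m m.

Let pG : 2.-group G. Proof. by case: settingG. Qed.

Let abelG' : 2.-abelem G^`(1). Proof. by case: settingG => _ _ _ []. Qed.

Let cardG' : #|G^`(1)| = 8. Proof. by case: settingG => _ _ _ []. Qed.

Let sG'Phi : G^`(1) \subset 'Phi(G).
Proof. by rewrite (Phi_joing pG) joing_subl. Qed.

Let sG'Z : G^`(1) \subset 'Z(G).
Proof. by case: settingG => _ _ sPZ _ _; apply: subset_trans sPZ. Qed.

Let sq1 g : g \in G^`(1) -> g ^+ 2 = 1.
Proof. by case/(abelemP (isT : prime 2)): abelG' => _; apply. Qed.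

Let nG' : G \subset 'N(G^`(1)). Proof. exact: der_norm. Qed.

Let memR g h : g \in G -> h \in G -> [~ g, h] \in G^`(1).
Proof. exact: mem_commg. Qed.

Let centR g h k : g \in G -> h \in G -> k \in G -> commute k [~ g, h].
Proof.
by move=> Gg Gh Gk; apply: (centerC Gk); apply: (subsetP sG'Z); apply: memR.
Qed.

(** Commutation is bilinear because G' is central. *)
Lemma commMl h : h \in G -> {in G &, {morph (fun g => [~ g, h]) : g k / g * k}}.
Proof.
move=> Gh g k Gg Gk; rewrite /= commMgJ conjgE -(centR Gg Gh Gk).
by rewrite mulKg.
Qed.

Lemma commMr g : g \in G -> {in G &, {morph (fun h => [~ g, h]) : h k / h * k}}.
Proof.
move=> Gg h k Gh Gk; rewrite /= commgMJ conjgE -(centR Gg Gh Gk) mulKg.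
by apply: (centsP (abelem_abelian abelG')); apply: memR.
Qed.

(* [g h] and [g^n h^n] differ by a commutator to the power n(n-1)/2, which is *)
(* even for n = 2^m precisely because m >= 2.                                 *)
Lemma pow2M : {in G &, {morph (@pow2 gT m) : g h / g * h}}.
Proof.
move=> g h Gg Gh; rewrite /pow2 expMg_Rmul; try exact: centR.
suffices -> : [~ h, g] ^+ 'C(2 ^ m, 2) = 1 by rewrite mulg1.
apply/eqP; rewrite -order_dvdn (@dvdn_trans 2) //.
  by rewrite order_dvdn sq1 // memR.
case: m m_ge2 => [|[|n]] // _; rewrite bin2 expnS mul2n -doubleMl doubleK.
by rewrite dvdn_mulr // expnS dvdn_mulr.
Qed.

Let abelQ : abelian (G / G^`(1)). Proof. exact: der_abelian. Qed.

Lemma quotient_card_exponent :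
  #|G / G^`(1)| = ((2 ^ m) ^ 3)%N /\ exponent (G / G^`(1)) %| 2 ^ m.
Proof.
case: settingG => _ _ _ _ [_ _ ty].
have [b defQ] := abelian_structure abelQ; rewrite ty.
case: b defQ => [|b1 [|b2 [|b3 [|]]]] //= defQ [o1 o2 o3].
rewrite -(bigdprod_card defQ) !big_cons big_nil -!orderE o1 o2 o3 muln1.
split=> //; rewrite !big_cons big_nil dprodg1 in defQ.
rewrite -(dprod_exponent defQ); case/dprodP: defQ => [[_ K _ defK] _ _ _].
rewrite defK -(dprod_exponent defK) !exponent_cycle o1 o2 o3.
by rewrite !dvdn_lcm !dvdnn.
Qed.

Lemma pow2_der g : g \in G -> pow2 m g \in G^`(1).
Proof.
move=> Gg; have Ng := subsetP nG' _ Gg; apply: coset_idr; first exact: groupX.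
rewrite morphX //; have [_ /exponentP->//] := quotient_card_exponent.
exact: mem_quotient.
Qed.

(** A decomposition of G / G' gives generators of G modulo G', hence of G, since G' lies in the
    Frattini subgroup. Conversely, the three factors have the same order 2^m, so [dprod_cycle3_card]
    applies to the images of any generating triple. *)
Lemma char_gens_generate (a : triple gT) :
  char_gens G m m m a.1.1 a.1.2 a.2 <-> <<set3 a>> = G.
Proof.
split=> [[[a1 a2 a3] defQ _] | defG].
  have sa : set3 a \subset G by rewrite set3_subset /in3 a1 a2.
  have sA : <<set3 a>> \subset G by rewrite gen_subG.
  apply: Phi_nongen; apply/eqP; rewrite eqEsubset join_subG Phi_sub sa /=.
  rewrite -joing_idr norm_joinEr; last first.
    exact: subset_trans sA (gFnorm _ _).
  apply: subset_trans (mulSg _ sG'Phi); rewrite -quotientSK //=.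
  case/dprodP: defQ => [[K _ defK _] <- _ _]; rewrite defK.
  case/dprodP: defK => _ <- _ _.
  have Aa g : g \in set3 a -> <[coset G^`(1) g]> \subset <<set3 a>> / G^`(1).
    by move=> ag; rewrite cycle_subG mem_quotient // mem_gen.
  by rewrite !mul_subG ?Aa ?inE ?eqxx ?orbT.
have /and3P[Ga1 Ga2 Ga3] : in3 G a by rewrite -set3_subset -defG subset_gen.
have [cardQ expQ] := quotient_card_exponent.
have [||||defQ oQ] := @dprod_cycle3_card _ (G / G^`(1)) (coset _ a.1.1)
  (coset _ a.1.2) (coset _ a.2) _ abelQ _ _ _ _ expQ cardQ.
- by rewrite mem_quotient.
- by rewrite mem_quotient.
- by rewrite mem_quotient.
- rewrite sub_quotient_pre //= (gens_subG _ defG).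
  rewrite set3_subset /in3 !mem_morphpre ?(subsetP nG') //=;
    by rewrite mem_gen // !inE eqxx ?orbT.
- by split.
Qed.

Lemma in3_gen (a : triple gT) : <<set3 a>> = G -> in3 G a.
Proof. by move=> <-; rewrite -set3_subset subset_gen. Qed.

Lemma is_char_matrixE (a : triple gT) (w : 'M['F_2]_3) :
  is_char_matrix G m m m a.1.1 a.1.2 a.2 w <->
  <<set3 a>> = G /\ map3 (pow2 m) a = map3 (word (comm3 a)) (bits w).
Proof.
(* A residue modulo 2 is 0 or 1, so it equals its own parity. *)
have wE i j : w i j = odd (w i j) :> nat.
  by case: (w i j) => -[|[|k]].
split=> [[/char_gens_generate genG E1 E2 E3] | [genG [E1 E2 E3]]].
  by split; rewrite // /map3 /pow2 E1 E2 E3 /word /= -!wE.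
split; first exact/char_gens_generate.
- by move: E1; rewrite /word /= -!wE.
- by move: E2; rewrite /word /= -!wE.
- by move: E3; rewrite /word /= -!wE.
Qed.

Lemma in3_comm3 a : in3 G a -> in3 G^`(1) (comm3 a).
Proof. by case/and3P=> *; rewrite /in3 !memR. Qed.

Lemma in3_pow2 a : in3 G a -> in3 G^`(1) (map3 (pow2 m) a).
Proof. by case/and3P=> *; rewrite /in3 !pow2_der. Qed.

(** Expand bilinearly; [g, g] = 1, and [h, g] = [g, h] because G' has exponent 2, so only x, y, z
    remain. *)
Lemma comm_word a u v :
  in3 G a -> [~ word a u, word a v] = word (comm3 a) (cross u v).
Proof.
move=> Ga; have Gc := in3_comm3 Ga; have /and3P[G1 G2 G3] := Ga.
have K g h : g \in G -> h \in G -> [~ h, g] = [~ g, h].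
  move=> Gg Gh; rewrite -invg_comm; apply/eqP; rewrite eq_invg_mul.
  by rewrite -expg2 sq1 ?memR.
pose c := word (comm3 a); pose v0 : bvec := (false, false, false).
have cE : [/\ c v0 = 1, c (true, false, false) = [~ a.1.2, a.2],
    c (false, true, false) = [~ a.2, a.1.1]
    & c (false, false, true) = [~ a.1.1, a.1.2]].
  by rewrite /c /word /= !mulg1 !mul1g.
case: cE => c0 c1 c2 c3.
have -> : [~ word a u, word a v] =
    word (map3 (fun h => [~ word a u, h]) a) v.
  by rewrite (morph_word _ (commMr (word_in _ Ga)) Ga).
have comm1 h : h \in G -> [~ word a u, h] = word (map3 (fun g => [~ g, h]) a) u.
  by move=> Gh; rewrite (morph_word _ (commMl Gh) Ga).
rewrite /map3 /= !comm1 // /map3 /= !commgg (K a.1.1 a.1.2) //.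
rewrite (K a.1.2 a.2) // (K a.2 a.1.1) // -c0 -c1 -c2 -c3.
(* The rows of [Mi] express [a_1, a_i], [a_2, a_i], [a_3, a_i] in x, y, z. *)
pose M1 := (v0, (false, false, true), (false, true, false)) : bmat.
pose M2 := ((false, false, true), v0, (true, false, false)) : bmat.
pose M3 := ((false, true, false), (true, false, false), v0) : bmat.
rewrite -[(c v0, _, _)]/(map3 c M1) -[(_, c v0, _)]/(map3 c M2).
rewrite -[(_, _, c v0)]/(map3 c M3) !(word_mulvm abelG') //.
rewrite -[(_, _, _)]/(map3 c (mulvm u M1, mulvm u M2, mulvm u M3)).
rewrite (word_mulvm abelG') //; congr (word _ _).
by case: u v {comm1} => [[[] []] []] [[[] []] []].
Qed.

(** Here v plays the role of the coordinates of g in G / Phi(G). The elements admitting such a v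
    form a subgroup, as powers and commutators are multiplicative, and it contains the
    generators. *)
Lemma gen_represent a g : <<set3 a>> = G -> g \in G ->
  exists v, pow2 m g = pow2 m (word a v) /\
            forall h, h \in G -> [~ g, h] = [~ word a v, h].
Proof.
move=> genG; have Ga := in3_gen genG.
have pE v : pow2 m (word a v) = word (map3 (pow2 m) a) v.
  exact: (morph_word _ pow2M Ga).
have cE h v : h \in G -> [~ word a v, h] = word (map3 (fun g => [~ g, h]) a) v.
  by move=> Gh; rewrite (morph_word _ (commMl Gh) Ga).
pose S := [set g in G | [exists v, (pow2 m g == pow2 m (word a v)) &&
  [forall (h | h \in G), [~ g, h] == [~ word a v, h]]]].
have SP k : reflect (k \in G /\ exists v, pow2 m k = pow2 m (word a v) /\
    forall h, h \in G -> [~ k, h] = [~ word a v, h]) (k \in S).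
  rewrite inE; apply: (iffP andP) => -[Gk].
    case/existsP=> v /andP[/eqP pv /forall_inP cv]; split=> //.
    by exists v; split=> // h Gh; apply/eqP/cv.
  case=> v [pv cv]; split=> //; apply/existsP; exists v.
  by rewrite pv eqxx; apply/forall_inP=> h Gh; rewrite cv.
have grS : group_set S.
  apply/group_setP; split=> [|k l /SP[Gk [u [pu cu]]] /SP[Gl [v [pv cv]]]].
    apply/SP; split=> //; exists (false, false, false).
    by rewrite /word !mulg1.
  apply/SP; split; first exact: groupM.
  exists (xorv u v); split=> [|h Gh].
    by rewrite pow2M // pu pv !pE (word_xorv abelG') // in3_pow2.
  rewrite commMl // cu // cv // !cE // (word_xorv abelG') //.
  by case/and3P: Ga => *; rewrite /in3 !memR.
suffices sGS : G \subset Group grS by move/(subsetP sGS)/SP=> [].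
rewrite (gens_subG _ genG); case/and3P: Ga => G1 G2 G3.
rewrite set3_subset; apply/and3P; split.
- apply/SP; split=> //; exists (true, false, false).
  by rewrite /word /= !mulg1.
- apply/SP; split=> //; exists (false, true, false).
  by rewrite /word /= mul1g mulg1.
- apply/SP; split=> //; exists (false, false, true).
  by rewrite /word /= !mul1g.
Qed.

Lemma der_word a :
  <<set3 a>> = G -> G^`(1) \subset [set word (comm3 a) v | v : bvec].
Proof.
move=> genG; have Ga := in3_gen genG; have Gc := in3_comm3 Ga.
have grW : group_set [set word (comm3 a) v | v : bvec].
  apply/group_setP; split=> [|_ _ /imsetP[u _ ->] /imsetP[v _ ->]].
    by apply/imsetP; exists (false, false, false); rewrite // /word !mulg1.
  by apply/imsetP; exists (xorv u v); rewrite // (word_xorv abelG').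
rewrite -[[set _ | _ : _]]/(gval (Group grW)) gen_subG.
apply/subsetP=> _ /imset2P[g h Gg Gh ->].
have [u [_ cu]] := gen_represent genG Gg.
have [v [_ cv]] := gen_represent genG Gh.
(* [gen_represent] replaces only the left entry of a commutator, so the second replacement passes
   through the inverse. *)
rewrite cu // -invg_comm cv ?word_in // invg_comm comm_word //.
exact: imset_f.
Qed.

(** Counting: 8 exponent vectors cover the 8 elements of G'. *)
Lemma word_comm3_inj a : <<set3 a>> = G -> injective (word (comm3 a)).
Proof.
move=> genG; have := subset_leq_card (der_word genG); rewrite cardG' => le8.
have card8 : #|[set: bvec]| = 8 by rewrite cardsT !card_prod !card_bool.
have /imset_injP inj :
    #|[set word (comm3 a) v | v in [set: bvec]]| == #|[set: bvec]|.
  rewrite eqn_leq leq_imset_card card8 (leq_trans le8) // subset_leq_card //.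
  by apply/subsetP=> _ /imsetP[v _ ->]; rewrite imset_f.
by move=> u v; apply: inj; rewrite !inE.
Qed.

Lemma pow2_matrix_exists a : <<set3 a>> = G ->
  exists W, map3 (pow2 m) a = map3 (word (comm3 a)) W.
Proof.
move=> genG; have /and3P[p1 p2 p3] := in3_pow2 (in3_gen genG).
have /imsetP[r1 _ e1] := subsetP (der_word genG) _ p1.
have /imsetP[r2 _ e2] := subsetP (der_word genG) _ p2.
have /imsetP[r3 _ e3] := subsetP (der_word genG) _ p3.
by exists (r1, r2, r3); rewrite /map3 /= -e1 -e2 -e3.
Qed.

Lemma comm3_words a X :
  in3 G a -> comm3 (map3 (word a) X) = map3 (word (comm3 a)) (cofm X).
Proof. by move=> Ga; rewrite /comm3 /= !comm_word. Qed.

Lemma pow2_words a W X :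
    in3 G a -> map3 (pow2 m) a = map3 (word (comm3 a)) W ->
  map3 (pow2 m) (map3 (word a) X) = map3 (word (comm3 a)) (mulm X W).
Proof.
move=> Ga pW; rewrite -(map3_word_mulm X W abelG') ?in3_comm3 // -pW.
by rewrite {1}/map3 /= !(morph_word _ pow2M Ga).
Qed.

(** In the elementary abelian quotient G / Phi(G), the inverse of X recovers the images of a from
    those of b, so b generates G modulo Phi(G), hence generates G. *)
Lemma gen_words a X :
  invertible_bmat X -> <<set3 a>> = G -> <<set3 (map3 (word a) X)>> = G.
Proof.
move=> /eqP invX genG; have Ga := in3_gen genG; set b := map3 _ _.
have Gb : in3 G b by rewrite /in3 !word_in.
have sbG : set3 b \subset G by rewrite set3_subset.
have sBG : <<set3 b>> \subset G by rewrite gen_subG.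
have nP : G \subset 'N('Phi(G)) by apply: gFnorm.
apply: Phi_nongen; apply/eqP; rewrite eqEsubset join_subG Phi_sub sbG /=.
rewrite -joing_idr norm_joinEr ?(subset_trans sBG) // -quotientSK //.
rewrite sub_quotient_pre // (gens_subG _ genG).
set f := coset 'Phi(G); pose A := map3 f a.
have fM : {in G &, {morph f : g h / g * h}}.
  by move=> g h Gg Gh; rewrite /f morphM ?(subsetP nP).
have QA : in3 (G / 'Phi(G))%G A.
  by case/and3P: Ga => *; rewrite /in3 !mem_quotient.
have QE : A = map3 f (map3 (word b) (transm (cofm X))).
  rewrite {1}/map3 !(morph_word _ fM Gb).
  have -> : map3 f b = map3 (word A) X.
    by rewrite /map3 /= !(morph_word _ fM Ga).
  rewrite -[RHS]/(map3 (word (map3 (word A) X)) (transm (cofm X))).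
  rewrite (map3_word_mulm _ _ (Phi_quotient_abelem pG)) // invX.
  by rewrite /map3 /word /= !mulg1 !mul1g.
have Bb v : f (word b v) \in <<set3 b>> / 'Phi(G).
  rewrite mem_quotient // word_in //.
  by rewrite -set3_subset subset_gen.
case: QE => e1 e2 e3; case/and3P: Ga => G1 G2 G3.
rewrite set3_subset /in3 !mem_morphpre ?(subsetP nP) //= -/f;
  by rewrite ?e1 ?e2 ?e3 Bb.
Qed.

(** In the old x, y, z the new powers have matrix X W and the new commutators [cofm X]; the equation
    X W = W' [cofm X] thus makes W' the new matrix. *)
Lemma congr_gens a X W W' :
    <<set3 a>> = G -> map3 (pow2 m) a = map3 (word (comm3 a)) W ->
    invertible_bmat X -> congr_by X W W' ->
  let b := map3 (word a) X in
  <<set3 b>> = G /\ map3 (pow2 m) b = map3 (word (comm3 b)) W'.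
Proof.
move=> genG pW invX /eqP cX b; have Ga := in3_gen genG.
split; first exact: gen_words.
rewrite (pow2_words _ Ga pW) cX comm3_words //.
by rewrite (map3_word_mulm _ _ abelG') // in3_comm3.
Qed.

(** The rows of X come from [gen_represent]: b need not equal the words given by X, but has the same
    powers and commutators. Comparing exponents in G' yields the congruence; independence of the
    commutators of b yields injectivity. *)
Lemma gens_congr a b W W' :
    <<set3 a>> = G -> map3 (pow2 m) a = map3 (word (comm3 a)) W ->
    <<set3 b>> = G -> map3 (pow2 m) b = map3 (word (comm3 b)) W' ->
  exists2 X, injective (mulvm^~ (cofm X)) & congr_by X W W'.
Proof.
move=> genG pW genG' pW'; have Ga := in3_gen genG; have Gc := in3_comm3 Ga.
have /and3P[Gb1 Gb2 Gb3] := in3_gen genG'.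
have [r1 [p1 c1]] := gen_represent genG Gb1.
have [r2 [p2 c2]] := gen_represent genG Gb2.
have [r3 [p3 c3]] := gen_represent genG Gb3.
pose X : bmat := (r1, r2, r3).
have cb : comm3 b = map3 (word (comm3 a)) (cofm X).
  rewrite -comm3_words // /comm3 /= c1 // c2 // c3 //.
  rewrite -(invg_comm b.2) -(invg_comm b.1.1) -(invg_comm b.1.2).
  by rewrite c1 ?c2 ?c3 ?word_in // !invg_comm.
have pb : map3 (pow2 m) b = map3 (pow2 m) (map3 (word a) X).
  by rewrite /map3 /= p1 p2 p3.
exists X => [u v /= uv|].
  apply: (word_comm3_inj genG'); rewrite cb !(word_mulvm abelG') //.
  by rewrite uv.
move: pW'; rewrite pb (pow2_words _ Ga pW) cb (map3_word_mulm _ _ abelG') //.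
case=> /(word_comm3_inj genG) e1 /(word_comm3_inj genG) e2.
move=> /(word_comm3_inj genG) e3.
by rewrite /congr_by /mulm /map3 e1 e2 e3.
Qed.

End CharacteristicGenerators.

(** * Transport along isomorphisms and the classification *)

Lemma morph_gens (gT hT : finGroupType) (G : {group gT}) (H : {group hT})
    (f : {morphism G >-> hT}) m a W :
    f @* G = H ->
    <<set3 a>> = G -> map3 (pow2 m) a = map3 (word (comm3 a)) W ->
  let b := map3 f a in
  <<set3 b>> = H /\ map3 (pow2 m) b = map3 (word (comm3 b)) W.
Proof.
move=> defH genG pW b; have Ga := in3_gen genG; have /and3P[G1 G2 G3] := Ga.
have fM : {in G &, {morph f : g h / g * h}} by move=> g h; apply: morphM.
split.
  have <- : f @* <<set3 a>> = H by rewrite genG.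
  by rewrite morphim_gen ?set3_subset // !morphimU !morphim_set1.
have Gc : in3 G (comm3 a) by rewrite /in3 !groupR.
have -> : map3 (pow2 m) b = map3 f (map3 (pow2 m) a).
  by rewrite /map3 /pow2 /= !morphX.
have -> : comm3 b = map3 f (comm3 a) by rewrite /map3 /comm3 /= !morphR.
by rewrite pW {1}/map3 /= !(morph_word _ fM Gc).
Qed.

Theorem theorem7p2 (m : nat) (hm : (2 <= m)%N) :
  (forall (gT : finGroupType) (G : {group gT}),
     char_setting G m m m ->
     exists (a1 a2 a3 : gT) (k : 'I_12),
       is_char_matrix G m m m a1 a2 a3 (tnth types_PQR k))
  /\
  (forall (gT hT : finGroupType) (G : {group gT}) (H : {group hT})
          (a1 a2 a3 : gT) (b1 b2 b3 : hT) (k l : 'I_12),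
     char_setting G m m m ->
     char_setting H m m m ->
     is_char_matrix G m m m a1 a2 a3 (tnth types_PQR k) ->
     is_char_matrix H m m m b1 b2 b3 (tnth types_PQR l) ->
     k <> l -> ~ (G \isog H)).
Proof.
split=> [gT G setG | gT hT G H a1 a2 a3 b1 b2 b3 k l setG setH].
  have [a genG] : exists a : triple gT, <<set3 a>> = G.
    have [_ d3 _ _ _] := setG; have [B genB] := grank_witness G.
    rewrite d3 => cardB; have cB : size (enum B) = 3 by rewrite -cardE.
    case eB: (enum B) cB => [|x [|y [|z [|]]]] // _; exists (x, y, z).
    rewrite -genB; congr <<_>>; apply/setP=> g.
    by rewrite -[in RHS]mem_enum eB !inE orbA.
  have [W pW] := pow2_matrix_exists hm setG genG.
  have [X [k [invX ltk cX]]] := congr_types_exists W.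
  have [genb pb] := congr_gens hm setG genG pW invX cX.
  set b := map3 _ X in genb pb.
  exists b.1.1, b.1.2, b.2, (Ordinal ltk).
  by apply/(is_char_matrixE setG b); rewrite bits_types.
move=> /(is_char_matrixE setG (a1, a2, a3)); rewrite bits_types => -[genG pG].
move=> /(is_char_matrixE setH (b1, b2, b3)); rewrite bits_types => -[genH pH].
(* The isomorphism is taken from H to G, so that the generators of H land beside those of G. *)
move=> neq_kl /isog_symr/isogP[f _ defG].
have [genf pf] := morph_gens defG genH pH.
have [X injX cX] := gens_congr hm setG genG pG genf pf.
by case: neq_kl; apply/val_inj/(congr_types_inj _ _ injX cX).
Qed.
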